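(* Let $\Bbbk$ be a field and let $I_\infty^{loop}=I_\infty\cap\mathrm{SL}_2(\Bbbk(\varpi)[u,u^{-1}])$, where $I_\infty\subset G=\mathrm{SL}_2(\Bbbk(\varpi)[u,u^{-1}])\rtimes\Bbbk(\varpi)^*$ is the negative twin Iwahori subgroup. Then $$I_\infty^{loop}\subset\begin{pmatrix}\varpi^{-1}\Bbbk[\varpi^{-1}][u,u^{-1}]+\Bbbk[u^{-1}]&\varpi^{-1}\Bbbk[\varpi^{-1}][u,u^{-1}]+u^{-1}\Bbbk[u^{-1}]\\ \varpi^{-1}\Bbbk[\varpi^{-1}][u,u^{-1}]+\Bbbk[u^{-1}]&\varpi^{-1}\Bbbk[\varpi^{-1}][u,u^{-1}]+\Bbbk[u^{-1}]\end{pmatrix}.$$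
   Context: $\varpi,u$ are indeterminates. The law of $G$ is $(M(\varpi,u),z)(M_1(\varpi,u),z_1)=(M(\varpi,u)M_1(\varpi,zu),zz_1)$; $\mathrm{SL}_2(\Bbbk(\varpi)[u,u^{-1}])$ is identified with $\mathrm{SL}_2(\Bbbk(\varpi)[u,u^{-1}])\times\{1\}\subset G$. $\mathcal O=\Bbbk[\varpi,\varpi^{-1}]$; $\omega_\ominus$ is the valuation on $\Bbbk(\varpi)$ trivial on $\Bbbk$ with $\omega_\ominus(\varpi^{-1})=1$. $G$ is the split Kac--Moody group over $\Bbbk(\varpi)$ with cocharacter lattice $Y=\mathbb Z\aleph^\vee\oplus\mathbb Zd$, character lattice $X=\mathbb Z\aleph\oplus\mathbb Z\delta$ ($\aleph(\aleph^\vee)=2$, $\aleph(d)=0$, $\delta(\aleph^\vee)=0$, $\delta(d)=1$), simple roots $\alpha_0=\delta-\aleph$, $\alpha_1=\aleph$, simple coroots $-\aleph^\vee,\aleph^\vee$, real roots $\Phi=\{\pm\aleph+k\delta:k\in\mathbb Z\}$, root groups $x_{\aleph+k\delta}(y)=(\begin{pmatrix}1&u^ky\\ 0&1\end{pmatrix},1)$, $x_{-\aleph+k\delta}(y)=(\begin{pmatrix}1&0\\ u^ky&1\end{pmatrix},1)$. $G_{twin}$ is the subgroup of $G$ generated by all $x_\alpha(\mathcal O)$, $\alpha\in\Phi$, and the elements of $G$ whose matrix part is diagonal or antidiagonal with nonzero entries in $\Bbbk^*\varpi^{\mathbb Z}u^{\mathbb Z}$ and whose second component is in $\Bbbk^*\varpi^{\mathbb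 Z}$. $I_\infty$ is the fixator in $G_{twin}$ of the local chamber $C_\infty$, germ at the origin $0_\ominus$ of $\{v:\alpha_0(v)<0,\alpha_1(v)<0\}$ in the standard apartment $\mathbb A_\ominus=Y\otimes\mathbb R$ of the masure of $G$ for $\omega_\ominus$. Equivalently $I_\infty=G_{C_\infty}\cap G_{twin}$ where $G_{C_\infty}$ (the fixator of $C_\infty$ in $G$) is generated by $\{(\mathrm{diag}(y,y^{-1}),z):\omega_\ominus(y)=\omega_\ominus(z)=0\}$ and the $x_\alpha(y)$ ($\alpha\in\Phi$, $y\in\Bbbk(\varpi)$) such that $\alpha+\omega_\ominus(y)\ge0$ on $C_\infty$ (i.e. on some neighbourhood of $0_\ominus$ in that cone). *)

(* Defs.v *)
From HB Require Import structures.
From mathcomp Require Import all_boot all_order all_algebra finmap.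
From mathcomp Require Import zify.
From mathcomp Require Import all_classical all_reals topology normedtype.

Set Implicit Arguments.
Unset Strict Implicit.
Unset Printing Implicit Defensive.

Import Order.TTheory GRing.Theory Num.Theory.
Import numFieldNormedType.Exports.

Local Open Scope classical_set_scope.
Local Open Scope ring_scope.

(* Laurent polynomials K[u, u^-1], as finitely supported families of
   coefficients indexed by int, with the convolution product. *)

Definition laurent (K : comNzRingType) : Type := {fsfun int -> K with 0}.

HB.instance Definition _ (K : comNzRingType) :=
  Choice.copy (laurent K) {fsfun int -> K with 0}.

Section LaurentRing.
Variable K : comNzRingType.
Implicit Types f g h : laurent K.

Definition lcoef f (n : int) : K := (f : {fsfun int -> K with 0}) n.

Definition lsupp f : {fset int} := finsupp (f : {fsfun int -> K with 0}).

Lemma lcoef_notin f n : n \notin lsupp f -> lcoef f n = 0.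
Proof. exact: fsfun_dflt. Qed.

Lemma laurentP f g : (forall n, lcoef f n = lcoef g n) <-> f = g.
Proof. by split=> [e|-> //]; apply/fsfunP => n; exact: e. Qed.

Definition lzero : laurent K := [fsfun].

Definition lopp f : laurent K := [fsfun n in lsupp f => - lcoef f n].

Definition ladd f g : laurent K :=
  [fsfun n in (lsupp f `|` lsupp g)%fset => lcoef f n + lcoef g n].

(* c u^m *)
Definition lmonom (c : K) (m : int) : laurent K := [fsfun n in [fset m]%fset => c].

Definition lmul f g : laurent K :=
  [fsfun n in [fset (i + j)%R | i in lsupp f, j in lsupp g]%fset =>
    \sum_(i <- lsupp f) lcoef f i * lcoef g (n - i)].

Lemma lcoef0 n : lcoef lzero n = 0.
Proof. by rewrite /lcoef /lzero fsfun0E. Qed.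

Lemma lcoefN f n : lcoef (lopp f) n = - lcoef f n.
Proof.
rewrite {1}/lcoef /lopp fsfun_fun.
by case: ifPn => // /lcoef_notin ->; rewrite oppr0.
Qed.

Lemma lcoefD f g n : lcoef (ladd f g) n = lcoef f n + lcoef g n.
Proof.
rewrite {1}/lcoef /ladd fsfun_fun in_fsetU.
case: ifPn => //; rewrite negb_or => /andP[/lcoef_notin -> /lcoef_notin ->].
by rewrite addr0.
Qed.

Lemma lcoef_monom c m n : lcoef (lmonom c m) n = if n == m then c else 0.
Proof. by rewrite /lcoef /lmonom fsfun_fun in_fset1. Qed.

Lemma lcoefM f g n :
  lcoef (lmul f g) n = \sum_(i <- lsupp f) lcoef f i * lcoef g (n - i).
Proof.
rewrite {1}/lcoef /lmul fsfun_fun; case: ifPn => // nS.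
rewrite big_seq big1 // => i iS; rewrite [X in _ * X]lcoef_notin ?mulr0 //.
apply: contra nS => nS; apply/imfset2P; exists i => //; exists (n - i) => //.
by rewrite addrC subrK.
Qed.

Lemma sum_supp (F : int -> K) (S T : {fset int}) :
  (forall i, i \notin S -> F i = 0) -> (forall i, i \notin T -> F i = 0) ->
  \sum_(i <- S) F i = \sum_(i <- T) F i.
Proof.
move=> FS FT; transitivity (\sum_(i <- (S `|` T)%fset) F i).
  by apply: big_fset_incl => [|i _ /FS //]; apply: fsubsetUl.
symmetry; apply: big_fset_incl => [|i _ /FT //]; exact: fsubsetUr.
Qed.

Lemma sum_reindex (F : int -> K) (s : int -> int) (S : {fset int}) :
  injective s ->
  \sum_(i <- S) F (s i) = \sum_(j <- [fset s i | i in S]%fset) F j.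
Proof. by move=> s_inj; rewrite big_imfset //= => i j _ _ /s_inj. Qed.

Lemma laddA : associative ladd.
Proof. by move=> f g h; apply/laurentP => n; rewrite !lcoefD addrA. Qed.

Lemma laddC : commutative ladd.
Proof. by move=> f g; apply/laurentP => n; rewrite !lcoefD addrC. Qed.

Lemma ladd0 : left_id lzero ladd.
Proof. by move=> f; apply/laurentP => n; rewrite lcoefD lcoef0 add0r. Qed.

Lemma laddN : left_inverse lzero lopp ladd.
Proof. by move=> f; apply/laurentP => n; rewrite lcoefD lcoefN lcoef0 addNr. Qed.

Lemma lmulC : commutative lmul.
Proof.
move=> f g; apply/laurentP => n; rewrite !lcoefM.
have s_inj : injective (fun i : int => n - i) by move=> i j /addrI/oppr_inj.
pose F j := lcoef f (n - j) * lcoef g j.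
rewrite [LHS](eq_bigr (fun i => F (n - i))); last first.
  by move=> i _; rewrite /F subKr.
rewrite (sum_reindex F _ s_inj) /F.
rewrite (@sum_supp _ _ (lsupp g)); first by apply: eq_bigr => i _; rewrite mulrC.
- move=> i iS; rewrite lcoef_notin ?mul0r //; apply: contra iS => iS.
  by apply/imfsetP; exists (n - i) => //; rewrite subKr.
- by move=> i /lcoef_notin ->; rewrite mulr0.
Qed.

Lemma lmulA : associative lmul.
Proof.
move=> f g h; apply/laurentP => n; rewrite !lcoefM.
pose S := [fset (i + j)%R | i in lsupp f, j in lsupp g]%fset.
have -> : \sum_(k <- lsupp (lmul f g)) lcoef (lmul f g) k * lcoef h (n - k) =
          \sum_(k <- S) lcoef (lmul f g) k * lcoef h (n - k).
  apply: sum_supp => k; first by move/lcoef_notin ->; rewrite mul0r.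
  by move=> kS; rewrite {1}/lcoef /lmul fsfun_fun (negbTE kS) mul0r.
under [RHS]eq_bigr => k _ do rewrite lcoefM mulr_suml.
rewrite exchange_big /= [LHS]big_seq [RHS]big_seq; apply: eq_bigr => i iS.
rewrite lcoefM mulr_sumr.
have s_inj : injective (fun k : int => k - i) by move=> k l /addIr.
pose F j := lcoef f i * (lcoef g j * lcoef h (n - i - j)).
rewrite [RHS](eq_bigr (fun k => F (k - i))); last first.
  by move=> k _; rewrite /F mulrA opprB addrA subrK.
rewrite (sum_reindex F _ s_inj); apply: sum_supp => j jS; rewrite /F.
  by rewrite [lcoef g j]lcoef_notin // mul0r mulr0.
rewrite [lcoef g j]lcoef_notin ?mul0r ?mulr0 //; apply: contra jS => jS.
apply/imfsetP; exists (i + j); last by rewrite addrAC subrr add0r.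
by apply/imfset2P; exists i => //; exists j.
Qed.

Lemma lmul1 : left_id (lmonom 1 0) lmul.
Proof.
move=> f; apply/laurentP => n; rewrite lcoefM.
rewrite (@sum_supp _ _ [fset (0 : int)]%fset).
- by rewrite big_seq_fset1 lcoef_monom eqxx mul1r subr0.
- by move=> i /lcoef_notin ->; rewrite mul0r.
- by move=> i; rewrite in_fset1 lcoef_monom => /negbTE ->; rewrite mul0r.
Qed.

Lemma lmulDl : left_distributive lmul ladd.
Proof.
move=> f g h; apply/laurentP => n.
rewrite ![lmul _ h]lmulC lcoefD !lcoefM -big_split /=.
by apply: eq_bigr => i _; rewrite lcoefD mulrDr.
Qed.

Lemma lone_neq0 : lmonom 1 0 != lzero.
Proof.
apply/eqP => /laurentP /(_ 0) /eqP.
by rewrite lcoef_monom lcoef0 eqxx oner_eq0.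
Qed.

HB.instance Definition _ := GRing.isZmodule.Build (laurent K)
  laddA laddC ladd0 laddN.

HB.instance Definition _ := GRing.Zmodule_isComNzRing.Build (laurent K)
  lmulA lmulC lmul1 lmulDl lone_neq0.

End LaurentRing.

Definition mx2 (L : Type) (a b c d : L) : 'M[L]_2 :=
  \matrix_(i, j) if i == 0 then (if j == 0 then a else b)
                 else (if j == 0 then c else d).

Lemma det2 (L : comNzRingType) (M : 'M[L]_2) :
  \det M = M 0 0 * M 1 1 - M 0 1 * M 1 0.
Proof.
rewrite (expand_det_row _ 0) !big_ord_recl big_ord0 addr0 /cofactor !det_mx11.
rewrite /= expr0 mul1r expr1 mulN1r mulrN !mxE /=.
by congr (M _ _ * M _ _ - M _ _ * M _ _); apply/val_inj.
Qed.

Lemma det_mx2 (L : comNzRingType) (a b c d : L) :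
  \det (mx2 a b c d) = a * d - b * c.
Proof. by rewrite det2 !mxE. Qed.

(* The group G = SL_2(K[u, u^-1]) x| K^*, where K^* rescales u. *)

Section SemidirectProduct.
Variable K : fieldType.
Implicit Types (f g : laurent K) (z : K).

(* f(u) |-> f(z u) *)
Definition rescale z f : laurent K :=
  [fsfun n in lsupp f => z ^ n * lcoef f n].

Lemma lcoef_rescale z f n : lcoef (rescale z f) n = z ^ n * lcoef f n.
Proof.
rewrite {1}/lcoef /rescale fsfun_fun.
by case: ifPn => // /lcoef_notin ->; rewrite mulr0.
Qed.

Lemma rescaleD z f g : rescale z (f + g) = rescale z f + rescale z g.
Proof.
by apply/laurentP => n; rewrite lcoefD !lcoef_rescale lcoefD mulrDr.
Qed.

Lemma rescaleN z f : rescale z (- f) = - rescale z f.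
Proof. by apply/laurentP => n; rewrite lcoefN !lcoef_rescale lcoefN mulrN. Qed.

Lemma rescale0 z : rescale z 0 = 0.
Proof. by apply/laurentP => n; rewrite lcoef_rescale lcoef0 mulr0. Qed.

Lemma rescale_monom z c m : rescale z (lmonom c m) = lmonom (z ^ m * c) m.
Proof.
apply/laurentP => n; rewrite lcoef_rescale !lcoef_monom.
by case: eqP => [->//|_]; rewrite mulr0.
Qed.

Lemma rescaleM z f g : z != 0 -> rescale z (f * g) = rescale z f * rescale z g.
Proof.
move=> z0; apply/laurentP => n; rewrite lcoef_rescale !lcoefM mulr_sumr.
rewrite [RHS](@sum_supp _ _ _ (lsupp f)).
- apply: eq_bigr => i _; rewrite !lcoef_rescale mulrACA -expfzDr //.
  by rewrite [i + _]addrC subrK.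
- by move=> i /lcoef_notin ->; rewrite mul0r.
- by move=> i /lcoef_notin e; rewrite lcoef_rescale e mulr0 mul0r.
Qed.

Lemma rescale1 f : rescale 1 f = f.
Proof. by apply/laurentP => n; rewrite lcoef_rescale exp1rz mul1r. Qed.

Lemma rescale_comp z z1 f : rescale z (rescale z1 f) = rescale (z * z1) f.
Proof. by apply/laurentP => n; rewrite !lcoef_rescale expfzMl mulrA. Qed.

Lemma rescale_1 z : rescale z 1 = 1.
Proof. by rewrite rescale_monom mul1r. Qed.

Definition rescale_mx z (M : 'M[laurent K]_2) : 'M[laurent K]_2 :=
  map_mx (rescale z) M.

Lemma rescale_mxM z (M N : 'M[laurent K]_2) : z != 0 ->
  rescale_mx z (M *m N) = rescale_mx z M *m rescale_mx z N.
Proof.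
move=> z0; apply/matrixP => i j; rewrite !mxE !big_ord_recl !big_ord0 !addr0.
by rewrite rescaleD !rescaleM // !mxE.
Qed.

Lemma rescale_mx_comp z z1 (M : 'M[laurent K]_2) :
  rescale_mx z (rescale_mx z1 M) = rescale_mx (z * z1) M.
Proof. by apply/matrixP => i j; rewrite !mxE rescale_comp. Qed.

Lemma rescale_mx_id (M : 'M[laurent K]_2) : rescale_mx 1 M = M.
Proof. by apply/matrixP => i j; rewrite !mxE rescale1. Qed.

Lemma rescale_mx1 z : rescale_mx z 1%:M = 1%:M.
Proof.
apply/matrixP => i j; rewrite !mxE.
by case: eqP => _; rewrite ?rescale_1 ?rescale0.
Qed.

Lemma det_rescale_mx z (M : 'M[laurent K]_2) : z != 0 ->
  \det (rescale_mx z M) = rescale z (\det M).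
Proof. by move=> z0; rewrite !det2 !mxE rescaleD rescaleN !rescaleM. Qed.

Definition in_G (p : 'M[laurent K]_2 * K) := (\det p.1 == 1) && (p.2 != 0).

Record G : predArgType := MkG { Gval :> 'M[laurent K]_2 * K; _ : in_G Gval }.

HB.instance Definition _ := [isSub for Gval].
HB.instance Definition _ := [Choice of G by <:].

Lemma G_det (p : G) : \det p.1 = 1.
Proof. by case: p => p /= /andP[/eqP]. Qed.

Lemma G_neq0 (p : G) : p.2 != 0.
Proof. by case: p => p /= /andP[]. Qed.

Lemma Gone_subproof : in_G (1%:M, 1).
Proof. by rewrite /in_G det1 eqxx oner_neq0. Qed.

Definition Gone : G := MkG Gone_subproof.

Lemma Gmul_subproof (p q : G) : in_G (p.1 *m rescale_mx p.2 q.1, p.2 * q.2).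
Proof.
rewrite /in_G /= det_mulmx det_rescale_mx ?G_neq0 // !G_det rescale_1 mulr1 eqxx.
by rewrite mulf_neq0 ?G_neq0.
Qed.

Definition Gmul (p q : G) : G := MkG (Gmul_subproof p q).

Lemma det_adj2 (M : 'M[laurent K]_2) : \det M = 1 -> \det (\adj M) = 1.
Proof.
by move=> M1; have := det_mulmx M (\adj M); rewrite mul_mx_adj M1 det1 mul1r.
Qed.

Lemma Ginv_subproof (p : G) : in_G (rescale_mx p.2^-1 (\adj p.1), p.2^-1).
Proof.
have z0 : p.2^-1 != 0 by rewrite invr_neq0 ?G_neq0.
by rewrite /in_G /= det_rescale_mx // det_adj2 ?G_det // rescale_1 eqxx.
Qed.

Definition Ginv (p : G) : G := MkG (Ginv_subproof p).

Lemma GmulA : associative Gmul.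
Proof.
move=> p q r; apply/val_inj; congr pair => /=; last exact: mulrA.
by rewrite rescale_mxM ?G_neq0 // rescale_mx_comp mulmxA.
Qed.

Lemma Gmul1 : left_id Gone Gmul.
Proof.
move=> p; apply/val_inj => /=; rewrite rescale_mx_id mul1mx mul1r.
by case: (Gval p).
Qed.

Lemma G1mul : right_id Gone Gmul.
Proof.
move=> p; apply/val_inj => /=; rewrite rescale_mx1 mulmx1 mulr1.
by case: (Gval p).
Qed.

Lemma GmulV : left_inverse Gone Ginv Gmul.
Proof.
move=> p; apply/val_inj => /=; have z0 := G_neq0 p.
by rewrite -rescale_mxM ?invr_neq0 // mul_adj_mx G_det rescale_mx1 mulVf.
Qed.

Lemma GVmul : right_inverse Gone Ginv Gmul.
Proof.
move=> p; apply/val_inj => /=; have z0 := G_neq0 p.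
by rewrite rescale_mx_comp divff // rescale_mx_id mul_mx_adj G_det.
Qed.

HB.instance Definition _ := isGroup.Build G GmulA Gmul1 G1mul GmulV GVmul.

Lemma xup_subproof (k : int) (y : K) : in_G (mx2 1 (lmonom y k) 0 1, 1).
Proof. by rewrite /in_G det_mx2 mulr0 subr0 mulr1 eqxx oner_neq0. Qed.

Lemma xlow_subproof (k : int) (y : K) : in_G (mx2 1 0 (lmonom y k) 1, 1).
Proof. by rewrite /in_G det_mx2 mul0r subr0 mulr1 eqxx oner_neq0. Qed.

(* The real root (-1)^s aleph + k delta is encoded by the pair (s, k). *)
Definition real_root : Type := bool * int.

Definition root_group (a : real_root) (y : K) : G :=
  if a.1 then MkG (xlow_subproof a.2 y) else MkG (xup_subproof a.2 y).

End SemidirectProduct.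

Definition is_subgroup (T : groupType) (H : set T) : Prop :=
  H 1%g /\ forall x y, H x -> H y -> H (x * y^-1)%g.

Definition generated (T : groupType) (S : set T) : set T :=
  smallest (@is_subgroup T) S.

(* Coordinates: the character p aleph + q delta is the pair (p, q), and the
   point a aleph^vee + b d of the apartment Y (x) R is the pair (a, b). *)

Definition character : Type := (int * int)%type.

Definition aleph : character := (1, 0).
Definition delta : character := (0, 1).

Definition alpha0 : character := (delta.1 - aleph.1, delta.2 - aleph.2).
Definition alpha1 : character := aleph.

Definition root_char (a : real_root) : character := ((-1) ^+ a.1, a.2).

(* aleph(aleph^vee) = 2, aleph(d) = 0, delta(aleph^vee) = 0, delta(d) = 1 *)
Definition pairing (R : realType) (chi : character) (v : R * R) : R :=
  chi.1%:~R * (2 * v.1) + chi.2%:~R * v.2.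

Definition chamber_germ (R : realType) : set_system (R * R) :=
  within [set v | pairing alpha0 v < 0 /\ pairing alpha1 v < 0]
         (nbhs ((0, 0) : R * R)).

Section RationalFunctions.
Variable k : fieldType.

Definition Kvarpi : fieldType := {fraction {poly k}}.

Definition of_poly (p : {poly k}) : Kvarpi := FracField.tofrac p.

Definition cst (c : k) : Kvarpi := of_poly c%:P.

Definition varpi : Kvarpi := of_poly 'X.

(* omega_ominus is minus the degree of a rational function; the lemmas below
   check that it is the valuation trivial on k with omega (varpi^-1) = 1. *)
Definition omega (y : Kvarpi) : \bar int :=
  if y == 0 then +oo%E
  else ((size \d_(repr y))%:Z - (size \n_(repr y))%:Z)%:E.

Lemma of_poly0 : of_poly 0 = 0. Proof. exact: rmorph0. Qed.
Lemma of_poly1 : of_poly 1 = 1. Proof. exact: rmorph1. Qed.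

Lemma of_polyD (p q : {poly k}) : of_poly (p + q) = of_poly p + of_poly q.
Proof. exact: rmorphD. Qed.

Lemma of_polyM (p q : {poly k}) : of_poly (p * q) = of_poly p * of_poly q.
Proof. exact: rmorphM. Qed.

Lemma of_poly_eq0 (p : {poly k}) : (of_poly p == 0) = (p == 0).
Proof. exact: tofrac_eq0. Qed.

Lemma repr_frac (y : Kvarpi) :
  y * of_poly \d_(repr y) = of_poly \n_(repr y).
Proof.
rewrite -{1}[y]reprK /of_poly; unlock FracField.tofrac.
rewrite -[LHS]FracField.pi_mul; apply/eqmodP; rewrite /= FracField.equivfE.
rewrite /FracField.mulf !numden_Ratio ?oner_neq0 ?mulr1 ?denom_ratioP //.
by rewrite mulrC.
Qed.

Lemma omega_frac (p q : {poly k}) : p != 0 -> q != 0 ->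
  omega (of_poly p / of_poly q) = ((size q)%:Z - (size p)%:Z)%:E.
Proof.
move=> p0 q0; set y := _ / _.
have y0 : y != 0 by rewrite mulf_neq0 ?invr_neq0 ?of_poly_eq0.
rewrite /omega (negbTE y0); congr (_%:E).
have d0 : \d_(repr y) != 0 := denom_ratioP _.
have e : p * \d_(repr y) = q * \n_(repr y).
  apply/eqP; rewrite -tofrac_eq; apply/eqP.
  rewrite -![FracField.tofrac _]/(of_poly _) !of_polyM -repr_frac /y.
  by rewrite mulrA mulrCA divff ?of_poly_eq0 // mulr1.
have n0 : \n_(repr y) != 0.
  apply: contra_neq p0 => n0; move/eqP: e.
  by rewrite n0 mulr0 mulf_eq0 (negbTE d0) orbF => /eqP.
have := congr1 (fun r : {poly k} => size r) e; rewrite !size_mul //.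
move: p0 q0 d0 n0; rewrite -!size_poly_gt0.
move: (size p) (size q) (size \d_(repr y)) (size \n_(repr y)) => a b c d. lia.
Qed.

Lemma fracP (y : Kvarpi) : y != 0 ->
  exists p q : {poly k}, [/\ p != 0, q != 0 & y = of_poly p / of_poly q].
Proof.
move=> y0; have d0 : \d_(repr y) != 0 := denom_ratioP _.
have fd0 : of_poly \d_(repr y) != 0 by rewrite of_poly_eq0.
exists \n_(repr y), \d_(repr y); split; [|exact: d0|].
  by have := mulf_neq0 y0 fd0; rewrite repr_frac of_poly_eq0.
by rewrite -repr_frac; symmetry; exact: mulfK.
Qed.

Lemma omega_eqy y : (omega y == +oo%E) = (y == 0).
Proof. by rewrite /omega; case: ifP. Qed.

Lemma omegaM y z : omega (y * z) = (omega y + omega z)%E.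
Proof.
have [->|y0] := eqVneq y 0; first by rewrite mul0r /omega eqxx; case: ifP.
have [->|z0] := eqVneq z 0; first by rewrite mulr0 /omega eqxx; case: ifP.
have [p [q [p0 q0 ->]]] := fracP y0; have [r [t [r0 t0 ->]]] := fracP z0.
rewrite mulrACA -invfM -!of_polyM !omega_frac ?mulf_neq0 //= !size_mul //.
congr (_%:E); move: p0 q0 r0 t0; rewrite -!size_poly_gt0.
move: (size p) (size q) (size r) (size t) => a b c d; lia.
Qed.

Lemma omegaD y z : (Order.min (omega y) (omega z) <= omega (y + z))%E.
Proof.
have [->|y0] := eqVneq y 0; first by rewrite add0r ge_min lexx orbT.
have [->|z0] := eqVneq z 0; first by rewrite addr0 ge_min lexx.
have [yz0|] := eqVneq (y + z) 0; first by rewrite {3}/omega yz0 eqxx leey.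
have [p [q [p0 q0 ->]]] := fracP y0; have [r [t [r0 t0 ->]]] := fracP z0.
rewrite addf_div ?of_poly_eq0 // -!of_polyM -of_polyD => yz0.
have s0 : p * t + r * q != 0.
  by apply: contra_neq yz0 => ->; rewrite of_poly0 mul0r.
rewrite !omega_frac ?mulf_neq0 // ge_min !lee_fin.
have := size_polyD (p * t) (r * q); rewrite leq_max !size_mul //.
move: p0 q0 r0 t0; rewrite -!size_poly_gt0.
move: (size (p * t + r * q)%R) (size p) (size q) (size r) (size t).
move=> e a b c d a0 b0 c0 d0 /orP[] le_e; apply/orP; [left|right];
  move: le_e a0 b0 c0 d0; lia.
Qed.

Lemma omega_cst c : c != 0 -> omega (cst c) = 0%E.
Proof.
move=> c0; rewrite -[cst c]divr1 -of_poly1 omega_frac ?oner_neq0 ?polyC_eq0 //.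
by rewrite size_poly1 size_polyC c0 subrr.
Qed.

Lemma omega_varpiV : omega varpi^-1 = 1%E.
Proof.
rewrite -[varpi^-1]mul1r -of_poly1 omega_frac ?oner_neq0 ?polyX_eq0 //.
by rewrite size_polyX size_poly1.
Qed.

(* O = k[varpi, varpi^-1] *)
Definition calO : set Kvarpi :=
  [set y | exists (p : {poly k}) (n : nat), y = of_poly p / varpi ^+ n].

(* k^* varpi^Z *)
Definition kstar_varpiZ : set Kvarpi :=
  [set y | exists (c : k) (i : int), c != 0 /\ y = cst c * varpi ^ i].

(* k^* varpi^Z u^Z *)
Definition kstar_varpiZ_uZ : set (laurent Kvarpi) :=
  [set f | exists (y : Kvarpi) (j : int), kstar_varpiZ y /\ f = lmonom y j].

(* varpi^-1 k[varpi^-1] *)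
Definition varpiV_kvarpiV : set Kvarpi :=
  [set y | exists p : {poly k}, y = varpi^-1 * (map_poly cst p).[varpi^-1]].

(* A[u, u^-1] *)
Definition laurent_over (A : set Kvarpi) : set (laurent Kvarpi) :=
  [set f | forall n, A (lcoef f n)].

Definition uV : laurent Kvarpi := lmonom 1 (-1).

(* k[u^-1] *)
Definition kuV : set (laurent Kvarpi) :=
  [set f | exists p : {poly k},
     f = (map_poly (fun c => lmonom (cst c) 0) p).[uV]].

(* u^-1 k[u^-1] *)
Definition uV_kuV : set (laurent Kvarpi) := [set uV * f | f in kuV].

Definition addset (A B : set (laurent Kvarpi)) : set (laurent Kvarpi) :=
  [set f + g | f in A & g in B].

Definition mx2_set (A B C D : set (laurent Kvarpi)) :
    set 'M[laurent Kvarpi]_2 :=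
  [set M | [/\ A (M 0 0), B (M 0 1), C (M 1 0) & D (M 1 1)]].

Definition twin_monomial : set (G Kvarpi) :=
  [set g | kstar_varpiZ g.2 /\
     exists a b : laurent Kvarpi, [/\ kstar_varpiZ_uZ a, kstar_varpiZ_uZ b &
       g.1 = mx2 a 0 0 b \/ g.1 = mx2 0 a b 0]].

Definition G_twin : set (G Kvarpi) :=
  generated ([set g | exists a y, calO y /\ g = root_group a y]
             `|` twin_monomial).

Definition torus0 : set (G Kvarpi) :=
  [set g | exists y z : Kvarpi, [/\ omega y = 0%E, omega z = 0%E &
     Gval g = (mx2 (lmonom y 0) 0 0 (lmonom y^-1 0), z)]].

Section Iwahori.
Variable R : realType.

(* alpha + omega (y) >= 0 on C_infty *)
Definition nonneg_on_Cinfty (a : real_root) (y : Kvarpi) : Prop :=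
  \forall v \near @chamber_germ R,
    (0 <= (pairing (root_char a) v)%:E + er_map intr (omega y))%E.

(* The fixator of the local chamber C_infty in the masure, through its
   generators. *)
Definition G_Cinfty : set (G Kvarpi) :=
  generated (torus0 `|`
    [set g | exists a y, nonneg_on_Cinfty a y /\ g = root_group a y]).

Definition I_infty : set (G Kvarpi) := G_Cinfty `&` G_twin.

(* The matrix M of SL_2 is identified with (M, 1). *)
Definition I_infty_loop : set 'M[laurent Kvarpi]_2 :=
  [set M | exists2 g, I_infty g & Gval g = (M, 1)].

End Iwahori.
End RationalFunctions.

(* Main.v *)
Require Import Defs.
From HB Require Import structures.
From mathcomp Require Import all_boot all_order all_algebra finmap.
From mathcomp Require Import zify lra.
From mathcomp Require Import all_classical all_reals topology normedtype.
(* cst denotes the constants of k(varpi), not the constant functions. *)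
Import Defs.

Set Implicit Arguments.
Unset Strict Implicit.
Unset Printing Implicit Defensive.

Import Order.TTheory GRing.Theory Num.Theory.
Import numFieldNormedType.Exports.

Local Open Scope classical_set_scope.
Local Open Scope ring_scope.

(** The two groups whose intersection is I_infty are both given by generators,
    so each one is bounded by exhibiting a subgroup of G containing its
    generators; in both cases the subgroup is cut out by conditions on the
    coefficients of the matrix entries.

    - For the fixator of the chamber C_infty, near the origin the roots
      aleph + k delta (k >= 0) and -aleph + k delta (k >= 1) are negative and
      arbitrarily small, the other real roots positive.  As omega takes integer
      values, a generator x_alpha(y) has omega(y) >= 1 for the former and
      omega(y) >= 0 for the latter.  Hence all coefficients of the entries
      have nonnegative valuation, and positive valuation in u-degree n > 0 and
      also, for the upper right entry, in degree n = 0.  These matrices form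
      the preimage, under reduction modulo the maximal ideal of the valuation
      ring, of the matrices over k[u^-1] that are lower triangular at
      u^-1 = 0: an order of M_2, stable under adjugates (hence under inverses
      of elements of SL_2) and under u |-> z u for omega(z) = 0
      (iwahori_graded_order, G_Cinfty_order).

    - For G_twin, the entries have coefficients in O = k[varpi, varpi^-1]
      (calO_graded_order, G_twin_order).

    An element of O of nonnegative valuation is a polynomial in varpi^-1: its
    constant term gives the part in k, which vanishes when the valuation is
    positive, and the rest lies in varpi^-1 k[varpi^-1] (calO_reduction).
    Splitting every coefficient of an entry in this way, the constant terms
    are supported in degrees n <= 0, or n < 0 in the upper right corner, and
    make up the element of k[u^-1], or u^-1 k[u^-1]
    (laurent_reduction). *)

(** * Subgroups of G defined by conditions on coefficients *)

Lemma ord2_cases (i : 'I_2) : i = 0 \/ i = 1.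
Proof. by case: i => [[|[|//]] ?]; [left|right]; exact/val_inj. Qed.

Lemma generated_sub (T : groupType) (S H : set T) :
  is_subgroup H -> S `<=` H -> generated S `<=` H.
Proof. by move=> Hsub SH g; apply. Qed.

Lemma adj2 (L : comNzRingType) (M : 'M[L]_2) :
  \adj M = mx2 (M 1 1) (- M 0 1) (- M 1 0) (M 0 0).
Proof.
apply/matrixP => i j; rewrite !mxE /cofactor det_mx11 !mxE.
have [->|->] := ord2_cases i; have [->|->] := ord2_cases j => /=;
  rewrite ?expr0 ?expr1 ?sqrrN ?expr1n ?mulN1r ?mul1r //;
  try congr (- _); congr (M _ _); exact/val_inj.
Qed.

Section GradedOrder.
Variable K : fieldType.
Implicit Types (P : 'I_2 -> 'I_2 -> int -> set K) (U : set K) (f g : laurent K).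

(** The families P i j n for which the matrices with entries in
    \bigoplus_n (P i j n) u^n form a graded order of M_2, with U a group of
    scalars z such that u |-> z u preserves it.  The diagonal condition makes
    the order stable under adjugates, which exchange the diagonal entries. *)
Record graded_order P U : Prop := GradedOrder {
  order_sub : forall i j n x y, P i j n x -> P i j n y -> P i j n (x - y);
  order_mul : forall i j l m n x y,
    P i j m x -> P j l n y -> P i l (m + n) (x * y);
  order0 : forall i j n, P i j n 0;
  order1 : forall i, P i i 0 1;
  order_diag : forall i j n, P i i n = P j j n;
  order_scale : forall z i j n x, U z -> P i j n x -> P i j n (z ^ n * x);
  units1 : U 1;
  units_div : forall y z, U y -> U z -> U (y / z) }.

Definition entries_in P U : set (G K) :=
  [set g : G K | (forall i j n, P i j n (lcoef ((Gval g).1 i j) n)) /\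
                 U (Gval g).2].

(** The inverse in SL_2 is the adjugate, whose entries are, up to sign, those of
    the matrix itself. *)
Lemma entries_in_subgroup P U :
  graded_order P U -> is_subgroup (entries_in P U).
Proof.
move=> [sub mul P0 P1 diag scale U1 Udiv].
have opp i j n x : P i j n x -> P i j n (- x).
  by move=> Px; rewrite -[- x]sub0r; exact: sub.
have add i j n x y : P i j n x -> P i j n y -> P i j n (x + y).
  by move=> Px Py; rewrite -[y]opprK; apply/sub/opp.
split=> [|x y [Px Ux] [Py Uy]]; split=> //=; last exact: Udiv.
  move=> i j n; rewrite mxE; case: eqVneq => [->|_] /=; last by rewrite lcoef0.
  by rewrite lcoef_monom; case: eqP => [->|_].
have Padj i j n : P i j n (lcoef (\adj (Gval y).1 i j) n).
  rewrite adj2 !mxE.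
  have [->|->] := ord2_cases i; have [->|->] := ord2_cases j => /=;
    rewrite ?lcoefN.
  - by rewrite (diag 0 1).
  - exact: opp.
  - exact: opp.
  - by rewrite (diag 1 0).
have PM i j l n f g : (forall m, P i j m (lcoef f m)) ->
    (forall m, P j l m (lcoef g m)) -> P i l n (lcoef (f * g) n).
  move=> Pf Pg; rewrite lcoefM; elim/big_ind: _ => // [|m _]; first exact: add.
  by rewrite -[X in P i l X](subrK m) addrC; exact: mul.
move=> i l n; rewrite rescale_mx_comp mxE !big_ord_recl big_ord0 addr0 lcoefD.
by apply: add; apply: PM => // m; rewrite mxE lcoef_rescale;
  apply: scale => //; exact: Udiv.
Qed.

Lemma entries_in_mx2 P U (g : G K) a b c d z :
  Gval g = (mx2 a b c d, z) ->
  (forall n, P 0 0 n (lcoef a n)) -> (forall n, P 0 1 n (lcoef b n)) ->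
  (forall n, P 1 0 n (lcoef c n)) -> (forall n, P 1 1 n (lcoef d n)) ->
  U z -> entries_in P U g.
Proof.
move=> gE Pa Pb Pc Pd Uz; rewrite /entries_in /= gE; split=> // i j n; rewrite mxE.
by have [->|->] := ord2_cases i; have [->|->] := ord2_cases j.
Qed.

Lemma order_lmonom P U i j n c m : graded_order P U ->
  P i j m c -> P i j n (lcoef (lmonom c m) n).
Proof.
by move=> PU Pc; rewrite lcoef_monom; case: eqP => [->|_] //; exact: order0 PU _ _ _.
Qed.

Lemma entries_in_root_group P U a y : graded_order P U ->
  (if a.1 then P 1 0 a.2 y else P 0 1 a.2 y) -> entries_in P U (root_group a y).
Proof.
move=> PU.
have P0 i j n : P i j n (lcoef 0 n) by rewrite lcoef0; exact: order0 PU _ _ _.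
have P1 i n : P i i n (lcoef 1 n).
  exact: order_lmonom PU (order1 PU i).
case: a => -[] m /= Py.
  apply: (@entries_in_mx2 _ _ _ 1 0 (lmonom y m) 1 1) => //.
    by move=> n; exact: order_lmonom PU Py.
  exact: units1 PU.
apply: (@entries_in_mx2 _ _ _ 1 (lmonom y m) 0 1 1) => //.
  by move=> n; exact: order_lmonom PU Py.
exact: units1 PU.
Qed.

End GradedOrder.

(** * The fixator of the chamber and the valuation *)

Section Valuation.
Variable k : fieldType.
Implicit Types (x y z : Kvarpi k) (m n : int).

Definition val_ge m : set (Kvarpi k) := [set y | (m%:E <= omega y)%E].

Lemma omega1 : omega (1 : Kvarpi k) = 0%E.
Proof.
have -> : 1 = cst 1 :> Kvarpi k by rewrite /cst /of_poly !rmorph1.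
by rewrite omega_cst ?oner_neq0.
Qed.

Lemma omegaN y : omega (- y) = omega y.
Proof.
have e : -1 = cst (-1) :> Kvarpi k by rewrite /cst /of_poly !rmorphN !rmorph1.
by rewrite -mulN1r e omegaM omega_cst ?add0e // oppr_eq0 oner_eq0.
Qed.

Lemma val_ge0 m : val_ge m 0.
Proof. by rewrite /val_ge /= /omega eqxx leey. Qed.

Lemma val_geB m x y : val_ge m x -> val_ge m y -> val_ge m (x - y).
Proof.
move=> mx my; apply: le_trans (omegaD x (- y)).
by rewrite omegaN le_min; apply/andP.
Qed.

Lemma val_geM m n x y : val_ge m x -> val_ge n y -> val_ge (m + n) (x * y).
Proof. by move=> mx ny; rewrite /val_ge /= omegaM EFinD leeD. Qed.

Lemma val_geW m n y : m <= n -> val_ge n y -> val_ge m y.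
Proof. by move=> mn; apply: le_trans; rewrite lee_fin. Qed.

Lemma omegaX y (n : nat) : omega y = 0%E -> omega (y ^+ n) = 0%E.
Proof.
move=> y0; elim: n => [|n IHn]; first by rewrite omega1.
by rewrite exprS omegaM y0 IHn adde0.
Qed.

Lemma omegaV y : omega y = 0%E -> omega y^-1 = 0%E.
Proof.
move=> y0; have yn0 : y != 0 by rewrite -omega_eqy y0.
by have := omegaM y y^-1; rewrite divff // omega1 y0 add0e.
Qed.

Lemma omegaXz y n : omega y = 0%E -> omega (y ^ n) = 0%E.
Proof. by move=> y0; case: n => n; [|apply: omegaV]; exact: omegaX. Qed.

(** The exponent is 1 when n > 0, or when n = 0 and (i, j) = (0, 1), and 0
    otherwise: adding the indicator of i < j to n encodes both cases at once,
    and makes the bound subadditive along i, j, l because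
    [i < l] <= [i < j] + [j < l]. *)
Definition iwahori_bound (i j : 'I_2) n : int := (0 < n + (i < j)%N%:Z)%R%:Z.

Definition iwahori_order i j n : set (Kvarpi k) := val_ge (iwahori_bound i j n).

Definition val_units : set (Kvarpi k) := [set z | omega z = 0%E].

Lemma iwahori_graded_order : graded_order iwahori_order val_units.
Proof.
split.
- by move=> i j n x y; exact: val_geB.
- move=> i j l m n x y mx ny; apply: val_geW (val_geM mx ny).
  rewrite /iwahori_bound.
  by have [->|->] := ord2_cases i; have [->|->] := ord2_cases j;
    have [->|->] := ord2_cases l => /=; lia.
- by move=> i j n; exact: val_ge0.
- by move=> i; rewrite /iwahori_order /val_ge /iwahori_bound /= ltnn /= omega1.
- by move=> i j n; rewrite /iwahori_order /iwahori_bound !ltnn.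
- move=> z i j n x z0 Px; rewrite /iwahori_order -[iwahori_bound _ _ _]add0r.
  by apply: val_geM => //; rewrite /val_ge /= omegaXz.
- exact: omega1.
- by move=> y z y0 z0; rewrite /val_units /= omegaM y0 omegaV // add0e.
Qed.

(** It suffices to test the inequality at one point of the chamber, namely
    (-t, -3t) with t small enough for the root to take there a value of absolute
    value less than 1: the sign of this value then decides the integer bound
    on omega y. *)
Lemma nonneg_on_Cinfty_order (R : realType) a y : nonneg_on_Cinfty R a y ->
  if a.1 then iwahori_order 1 0 a.2 y else iwahori_order 0 1 a.2 y.
Proof.
case: a => s m; rewrite /nonneg_on_Cinfty /chamber_germ.
move=> /nbhs_ballP[e /= e0 near0].
(* t * M bounds the absolute value of the root at (-t, -3t). *)
pose M : R := 2 + 3 * `|m%:~R|.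
have M0 : 0 < M by rewrite /M; have := normr_ge0 (m%:~R : R); lra.
have e4 : 0 < e / 4 by rewrite divr_gt0.
have M2 : 0 < M^-1 / 2 by rewrite divr_gt0 ?invr_gt0.
pose t := Num.min (e / 4) (M^-1 / 2).
have t0 : 0 < t by rewrite lt_min e4.
have te : 3 * t < e by have : t <= e / 4; [rewrite ge_min lexx | lra].
have tM : t * M < 1.
  have : t <= M^-1 / 2 by rewrite ge_min lexx orbT.
  rewrite -(ler_pM2r M0) mulrAC mulVf ?gt_eqF //; lra.
have : (0 <= (pairing (root_char (s, m)) (- t, - (3 * t)))%:E
          + er_map intr (omega y))%E.
  apply: near0; last by rewrite /pairing /=; lra.
  split; rewrite /= /ball /= sub0r opprK ger0_norm; lra.
rewrite /iwahori_order /val_ge /= /pairing /root_char /=.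
case: (omega y) {near0} => [r| |] /=; last 2 first.
- by case: s; rewrite !leey.
- by rewrite addeNy leeNy_eq.
rewrite -EFinD !lee_fin => r0.
have [mM Mm] : m%:~R <= `|m%:~R : R| /\ - (m%:~R) <= `|m%:~R : R|.
  by split; [exact: ler_norm|rewrite -normrN ler_norm].
have lt1 (x : int) : (-1 < x%:~R :> R) -> 0 <= x.
  by rewrite -[-1]/((-1)%:~R) ltr_int; lia.
have lt0 (x : int) : (0 < x%:~R :> R) -> 1 <= x.
  by rewrite -[0]/(0%:~R) ltr_int; lia.
rewrite /iwahori_bound.
case: s r0 => /= r0; case: ltP => /= hm.
- apply: lt0; have : (1 <= m%:~R :> R) by rewrite -[1]/(1%:~R) ler_int; lia.
  move: r0; rewrite expr1; nra.
- apply: lt1; move: r0 tM; rewrite expr1 /M; nra.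
- apply: lt0; have : (0 <= m%:~R :> R) by rewrite -[0]/(0%:~R) ler_int; lia.
  move: r0; rewrite expr0; nra.
- apply: lt1; move: r0 tM; rewrite expr0 /M; nra.
Qed.

Lemma G_Cinfty_order (R : realType) :
  @G_Cinfty k R `<=` entries_in iwahori_order val_units.
Proof.
have PU := iwahori_graded_order; apply: generated_sub.
  exact: entries_in_subgroup.
move=> g [[y [z [y0 z0 gE]]]|[a [y [ya ->]]]].
  apply: entries_in_mx2 gE _ _ _ _ z0 => n; rewrite ?lcoef0;
    try (exact: (order0 PU)); apply: (order_lmonom _ PU).
    by rewrite /iwahori_order /val_ge /iwahori_bound /= y0.
  by rewrite /iwahori_order /val_ge /iwahori_bound /= omegaV.
by apply: entries_in_root_group => //; exact: nonneg_on_Cinfty_order ya.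
Qed.

End Valuation.

(** * The twin group and the coefficients in k[varpi, varpi^-1] *)

Section LaurentCoefficients.
Variable k : fieldType.
Implicit Types (y z : Kvarpi k) (p q : {poly k}).

HB.instance Definition _ := GRing.RMorphism.copy (@of_poly k)
  (@FracField.tofrac {poly k}).
HB.instance Definition _ := GRing.RMorphism.copy (@cst k)
  (@of_poly k \o @polyC k).

Lemma varpi_neq0 : varpi k != 0.
Proof. by rewrite of_poly_eq0 polyX_eq0. Qed.

Lemma of_polyXn n : of_poly 'X^n = varpi k ^+ n.
Proof. exact: rmorphXn. Qed.

Lemma kstar_varpiZ_calO y : kstar_varpiZ y -> calO y.
Proof.
move=> [c [[i|i] [_ ->]]].
  exists (c%:P * 'X^i), 0%N.
  by rewrite expr0 divr1 of_polyM of_polyXn.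
by exists c%:P, i.+1.
Qed.

Lemma calO_graded_order :
  graded_order (fun _ _ _ => @calO k) (@kstar_varpiZ k).
Proof.
have v0 n : varpi k ^+ n != 0 by rewrite expf_neq0 ?varpi_neq0.
have calOM y z : calO y -> calO z -> calO (y * z).
  move=> [p [a ->]] [q [b ->]]; exists (p * q), (a + b)%N.
  by rewrite of_polyM exprD invfM mulrACA.
split => //.
- move=> _ _ _ y z [p [a ->]] [q [b ->]].
  exists (p * 'X^b - q * 'X^a), (a + b)%N.
  by rewrite -mulNr addf_div // exprD rmorphB /= !of_polyM !of_polyXn mulNr.
- by move=> _ _ _; exists 0, 0%N; rewrite of_poly0 mul0r.
- by move=> _; exists 1, 0%N; rewrite of_poly1 expr0 divr1.
- move=> z _ _ n y [c [i [c0 ->]]] Oy; apply: calOM Oy.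
  apply: kstar_varpiZ_calO; exists (c ^ n), (i * n).
  by rewrite expfz_neq0 // expfzMl -fmorphXz exprz_exp.
- by exists 1, 0; rewrite oner_neq0 rmorph1 mul1r expr0z.
- move=> _ _ [c [i [c0 ->]]] [d [j [d0 ->]]].
  exists (c / d), (i - j); split; first by rewrite mulf_neq0 ?invr_neq0.
  by rewrite fmorph_div expfzDr ?varpi_neq0 // -invr_expz invfM mulrACA.
Qed.

Lemma G_twin_order :
  @G_twin k `<=` entries_in (fun _ _ _ => @calO k) (@kstar_varpiZ k).
Proof.
have PU := calO_graded_order; apply: generated_sub.
  exact: entries_in_subgroup.
move=> g [[a [y [Oy ->]]]|]; first by apply: entries_in_root_group => //; case: ifP.
have mono (f : laurent (Kvarpi k)) n : kstar_varpiZ_uZ f -> calO (lcoef f n).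
  move=> [y [j [ky ->]]]; have Oy : calO y by exact: kstar_varpiZ_calO.
  exact: (@order_lmonom _ _ _ 0 0 n _ _ PU).
have calO0 n : calO (lcoef (0 : laurent (Kvarpi k)) n).
  by rewrite lcoef0; exact: (order0 PU 0 0 0).
case: g => -[M z] gG [/= Uz [a [b [kUa kUb]]]].
have Oa n := mono a n kUa; have Ob n := mono b n kUb.
by rewrite /entries_in /= => ME; split=> // i j n; case: ME => ->; rewrite mxE;
  case: ifP => _; case: ifP.
Qed.

(** If y = p / varpi^n, then omega y >= 0 says that p has degree at most n, so
    that y is a polynomial in varpi^-1 with constant term p`_n; and
    omega y >= 1 says that p has degree less than n. *)
Lemma calO_reduction y : calO y -> val_ge 0 y ->
  exists a v, [/\ varpiV_kvarpiV v, y = cst a + v & val_ge 1 y -> a = 0].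
Proof.
move=> [p [n yE]] y0; have v0 := varpi_neq0.
have vn0 : varpi k ^+ n != 0 by rewrite expf_neq0.
have omegaE : p != 0 -> omega y = (n.+1%:Z - (size p)%:Z)%:E.
  move=> p0; rewrite yE -of_polyXn omega_frac ?size_polyXn //.
  by rewrite -size_poly_gt0 size_polyXn.
have szp : (size p <= n.+1)%N.
  have [->|p0] := eqVneq p 0; first by rewrite size_poly0.
  by move: y0; rewrite /val_ge /= omegaE // lee_fin subr_ge0 lez_nat.
pose q : {poly k} := \sum_(i < n) p`_i *: 'X^(n.-1 - i).
exists p`_n, ((varpi k)^-1 * (map_poly (@cst k) q).[(varpi k)^-1]); split.
- by exists q.
- rewrite yE; apply: (mulIf vn0); rewrite mulfVK //.
  have -> : of_poly p = \sum_(i < n.+1) cst p`_i * varpi k ^+ i.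
    rewrite -[in LHS](take_poly_id szp) /take_poly poly_def rmorph_sum.
    by apply: eq_bigr => i _; rewrite -mul_polyC -of_polyXn; exact: of_polyM.
  rewrite big_ord_recr /= addrC mulrDl; congr (_ + _).
  rewrite rmorph_sum horner_sum mulr_sumr mulr_suml; apply: eq_bigr => i _.
  rewrite /= map_polyZ map_polyXn hornerZ hornerXn mulrCA -mulrA; congr (_ * _).
  have nE : n = ((n.-1 - i).+1 + i)%N by have := ltn_ord i; lia.
  by rewrite -exprS exprVn [in varpi k ^+ n]nE exprD mulKf ?expf_neq0.
- have [->|p0] := eqVneq p 0; first by rewrite coef0.
  rewrite /val_ge /= omegaE // lee_fin lerBrDr lez_nat; exact: nth_default.
Qed.

Lemma lcoef_monomM (c : Kvarpi k) m f n :
  lcoef (lmonom c m * f) n = c * lcoef f (n - m).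
Proof.
rewrite lcoefM (@sum_supp _ _ _ [fset m]%fset).
- by rewrite big_seq_fset1 lcoef_monom eqxx.
- by move=> i /lcoef_notin ->; rewrite mul0r.
- by move=> i; rewrite in_fset1 lcoef_monom => /negbTE ->; rewrite mul0r.
Qed.

Lemma uVX i : uV k ^+ i = lmonom 1 (- i%:Z).
Proof.
elim: i => [|i IHi]; first by rewrite expr0 oppr0.
apply/laurentP => n; rewrite exprS IHi lcoef_monomM mul1r !lcoef_monom.
by congr (if _ then _ else _); lia.
Qed.

Lemma lcoef_horner_uV p n :
  lcoef (map_poly (fun c => lmonom (cst c) 0) p).[uV k] n =
  if n <= 0 then cst p`_`|n| else 0.
Proof.
rewrite /map_poly horner_poly.
rewrite (big_morph (fun f => lcoef f n) (fun f g => lcoefD f g n) (lcoef0 _ n)).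
under eq_bigr => i _.
  rewrite uVX lcoef_monomM subr0 lcoef_monom; over.
case: ifPn => n0; last first.
  rewrite big1 // => i _; rewrite ifF ?mulr0 //; lia.
have [lt_n|le_n] := ltnP `|n| (size p).
  rewrite (bigD1 (Ordinal lt_n)) //= ifT; last lia.
  rewrite mulr1 big1 ?addr0 // => i; rewrite -val_eqE /= => ni.
  by rewrite ifF ?mulr0 //; lia.
rewrite nth_default // rmorph0 big1 // => i _.
by rewrite ifF ?mulr0 //; have := ltn_ord i; lia.
Qed.

(** The flag b tells k[u^-1] (b = 0) from u^-1 k[u^-1] (b = 1). *)
Lemma laurent_reduction (b : bool) (f : laurent (Kvarpi k)) :
  (forall n, calO (lcoef f n)) ->
  (forall n, val_ge (0 < n + b%:Z)%R%:Z (lcoef f n)) ->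
  addset (laurent_over (@varpiV_kvarpiV k))
    [set uV k ^+ b * h | h in @kuV k] f.
Proof.
move=> Of vf.
have /choice[a aP] n : exists a, varpiV_kvarpiV (lcoef f n - cst a) /\
    (val_ge 1 (lcoef f n) -> a = 0).
  have [|a [v [vV -> av]]] := calO_reduction (Of n).
    by apply: val_geW (vf n); lia.
  by exists a; rewrite addrAC subrr add0r.
have a_pos n : 0 < n + b%:Z -> a n = 0.
  by move=> n0; apply: (aP n).2; have := vf n; rewrite n0.
(* The finite support of f bounds the degree in u^-1 of the constant terms. *)
pose N := (\max_(i <- lsupp f) `|i|%N)%N.
have a_big n : (N < `|n|)%N -> a n = 0.
  move=> Nn; apply: (aP n).2; rewrite lcoef_notin; first exact: val_ge0.
  by apply: contraL Nn => nf; rewrite -leqNgt; exact: leq_bigmax_seq.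
pose p : {poly k} := \poly_(i < N.+1) a (- i%:Z - b%:Z).
pose h := (map_poly (fun c => lmonom (cst c) 0) p).[uV k].
exists (f - uV k ^+ b * h); last first.
  by exists (uV k ^+ b * h); [exists h => //; exists p|rewrite subrK].
move=> n; rewrite lcoefD lcoefN uVX lcoef_monomM mul1r opprK /h lcoef_horner_uV.
case: ifPn => [n0|]; last first.
  by rewrite -ltNge => /a_pos an; have [] := aP n; rewrite an rmorph0.
have -> : p`_`|n + b%:Z| = a n; last by case: (aP n).
rewrite coef_poly; case: ltnP => [_|le_N]; first by congr a; lia.
by rewrite a_big //; lia.
Qed.

End LaurentCoefficients.

Theorem lemma6p11 (R : realType) (k : fieldType) :
  @I_infty_loop k R `<=`
  mx2_set
    (addset (laurent_over (@varpiV_kvarpiV k)) (@kuV k))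
    (addset (laurent_over (@varpiV_kvarpiV k)) (@uV_kuV k))
    (addset (laurent_over (@varpiV_kvarpiV k)) (@kuV k))
    (addset (laurent_over (@varpiV_kvarpiV k)) (@kuV k)).
Proof.
move=> M [g [/G_Cinfty_order[vM _] /G_twin_order[OM _]] gE].
rewrite gE /= in vM OM.
have entry i j := laurent_reduction (OM i j) (vM i j).
have uV0 : [set uV k ^+ false * h | h in @kuV k] = @kuV k.
  apply/seteqP; split=> [_ [h hk <-]|h hk]; first by rewrite expr0 mul1r.
  by exists h; rewrite // expr0 mul1r.
by have := (entry 0 0, entry 0 1, entry 1 0, entry 1 1);
  rewrite /= uV0 => -[[[? ?] ?] ?].
Qed.
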